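(* Let $f:\mathbb{R}^d\to\mathbb{R}$ be convex and $G$-Lipschitz, and let $\nabla f(x)$ denote a subgradient of $f$ at $x$. Let $R>0$, $\gamma=G/R$, and $\hat\beta_k=1/(k+1)^{\overline{-1/2}}$ for $k\ge0$. Consider the dual averaging method with $x_0=0$, $s_0=0$ and, for $k\ge 0$, $$s_{k+1}=s_k+\nabla f(x_k),\qquad x_{k+1}=\arg\min_{x\in\mathbb{R}^d}\left\{\langle s_{k+1},x\rangle+\hat\beta_{k+1}\frac{\gamma}{2}\|x-x_0\|^2\right\}.$$ Then for every $n\ge 0$, $$\max_{x:\,\|x\|\le R}\left\{\frac{1}{n+1}\sum_{i=0}^{n}\langle\nabla f(x_i),x_i-x\rangle\right\}\le 2RG\,(n+2)^{\overline{-1/2}}<\frac{2RG}{\sqrt{n+1}}.$$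
   Context: Factorial powers: for real $x>0$ and real $r$ with $x+r>0$, $x^{\overline{r}}:=\Gamma(x+r)/\Gamma(x)$, where $\Gamma$ is the Gamma function. *)

(* Defs.v *)
From HB Require Import structures.
From mathcomp Require Import all_boot all_order all_algebra.
From mathcomp Require Import all_classical all_reals all_analysis.
Set Implicit Arguments. Unset Strict Implicit. Unset Printing Implicit Defensive.
Import Order.TTheory GRing.Theory Num.Theory.
Import numFieldNormedType.Exports.
Local Open Scope classical_set_scope.
Local Open Scope ring_scope.

Definition dotp {R : realType} {d : nat} (u v : 'rV[R]_d) : R :=
  \sum_(i < d) u ord0 i * v ord0 i.
Definition enorm {R : realType} {d : nat} (u : 'rV[R]_d) : R :=
  Num.sqrt (dotp u u).

Definition Gamma {R : realType} (x : R) : R :=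
  fine (\int[@lebesgue_measure R]_(t in `]0%R, +oo[%classic)
          ((t `^ (x - 1)) * expR (- t))%:E)%E.

Definition rfpow {R : realType} (x r : R) : R := Gamma (x + r) / Gamma x.

Definition beta_hat {R : realType} (k : nat) : R :=
  1 / rfpow (k.+1%:R) (- (1 / 2)).

Definition convex_fun {R : realType} {d : nat} (f : 'rV[R]_d -> R) : Prop :=
  forall (x y : 'rV[R]_d) (t : R), 0 <= t -> t <= 1 ->
    f (t *: x + (1 - t) *: y) <= t * f x + (1 - t) * f y.

Definition lipschitz_with {R : realType} {d : nat} (G : R) (f : 'rV[R]_d -> R) : Prop :=
  forall x y : 'rV[R]_d, `|f x - f y| <= G * enorm (x - y).

Definition is_subgradient {R : realType} {d : nat} (f : 'rV[R]_d -> R) (x v : 'rV[R]_d) : Prop :=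
  forall y : 'rV[R]_d, f x + dotp v (y - x) <= f y.

(* Main.v *)
Require Import Defs.
From HB Require Import structures.
From mathcomp Require Import all_boot all_order all_algebra.
From mathcomp Require Import all_classical all_reals all_analysis.
From mathcomp Require Import measurable_realfun ring lra.
Import Order.TTheory GRing.Theory Num.Theory.
Import numFieldNormedType.Exports.
Local Open Scope ring_scope.

(* Write c_k = (k+1)^{rising -1/2} = Gamma(k+1/2)/Gamma(k+1) = 1/beta_k and
   gamma = G/R. The minimizer is x_k = -(c_k/gamma) s_k, so the potential
   sum_{i<=n} <g_i, x_i> + c_{n+1} |s_{n+1}|^2 / (2 gamma) grows by at most
   c_{n+1} G^2 / (2 gamma) per step because c decreases. The choice of c makes
   2 k c_k an exact antidifference of c_k, so the potential is at most
   G R (n+1) c_{n+1}. Young's inequality turns this into the regret bound as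
   soon as c_{n+1}^2 >= 1/(2(n+1)). This and c_{n+1}^2 < 1/(n+1) come from
   Gamma(x+1/2) <= sqrt(x) Gamma(x), an AM-GM inequality between integrands. *)

(** * Gamma on [1, +oo): recurrence, finiteness and the half-step inequality *)

Section GammaFunction.
Context {R : realType}.
Implicit Types x y t : R.
Local Notation mu := (@lebesgue_measure R).

(** For t >= 1, t^x <= t^(n+1) and t^(n+2) <= (n+2)! e^t, so the product is at most (n+2)!/t. *)
Lemma powR_expRN_cvg0 x : (t `^ x * expR (- t) @[t --> +oo] --> (0 : R))%classic.
Proof.
set n := Num.truncn x; pose K : R := (n.+2)`!%:R.
have K0 : 0 < K by rewrite ltr0n fact_gt0.
apply/cvgrPdist_le => /= e e0; near=> t.
have t1 : 1 <= t by near: t; exact: nbhs_pinfty_ge.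
have t0 : 0 < t by rewrite (lt_le_trans _ t1).
have tK : K <= e * t.
  by rewrite mulrC -ler_pdivrMr//; near: t; exact: nbhs_pinfty_ge.
rewrite sub0r normrN ger0_norm ?mulr_ge0 ?powR_ge0 ?expR_ge0//.
rewrite expRN ler_pdivrMr ?expR_gt0//.
have txn : t `^ x <= t ^+ n.+1.
  by rewrite -powR_mulrn ?(ltW t0)// ler_powR// ltW// truncnS_gt.
have tnK : t ^+ n.+2 <= K * expR t.
  rewrite mulrC -ler_pdivrMr//.
  by apply: le_trans (expR_ge1Dxn n.+1 (ltW t0)); rewrite lerDr.
rewrite -(ler_pM2l K0) mulrCA; apply: le_trans (_ : e * t ^+ n.+2 <= _).
  by rewrite exprS mulrA ler_pM ?powR_ge0 ?(ltW K0).
by rewrite ler_pM2l.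
Unshelve. all: by end_near. Qed.

Lemma powR_cvg_right0 x : 0 <= x -> (t `^ x @[t --> (0:R)^'+] --> (0:R) `^ x)%classic.
Proof.
rewrite le_eqVlt => /predU1P[<-|x0].
  have -> : (fun t : R => t `^ 0) = cst 1 by apply/funext => t; rewrite powRr0.
  by rewrite powRr0; exact: cvg_cst.
by rewrite powR0 ?gt_eqF//; exact: powR_cvg0.
Qed.

Let gammaf x t : R := t `^ (x - 1) * expR (- t).

(** Kept in the extended reals: [fine] sends +oo to 0, so the recurrence is proved for [gint] first
    and finiteness is deduced from it. *)
Let gint x : \bar R := (\int[mu]_(t in `]0%R, +oo[%classic) (gammaf x t)%:E)%E.

Let gammaf_ge0 x t : 0 <= gammaf x t.
Proof. by rewrite mulr_ge0 ?powR_ge0 ?expR_ge0. Qed.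

Let measurable_expRN (D : set R) : measurable_fun D (fun t : R => expR (- t)).
Proof. by apply: measurable_funTS; apply: measurableT_comp. Qed.

Let measurable_gammaf x (D : set R) : measurable_fun D (gammaf x).
Proof.
apply: measurable_funM; last exact: measurable_expRN.
by apply: measurable_funTS; exact: measurable_powR.
Qed.

Let measurable_EFin_gammaf x (D : set R) : measurable_fun D (fun t => (gammaf x t)%:E).
Proof. by apply/measurable_EFinP; exact: measurable_gammaf. Qed.

Let integral_expRN (C : R) :
  0 <= C ->
  (\int[mu]_(t in `]0%R, +oo[%classic) (C * expR (- t))%:E = C%:E)%E.
Proof.
move=> C0; rewrite integral_itv_obnd_cbnd; last first.
  by apply/measurable_EFinP; apply: measurable_funM => //; exact: measurable_expRN.
have cN (K : R) : (continuous (fun t : R => K * expR (- t)))%classic.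
  move=> t; apply/differentiable_continuous/derivable1_diffP; exact: ex_derive.
rewrite (@ge0_continuous_FTC2y _ _ (fun t : R => - C * expR (- t)) 0 0).
- by rewrite oppr0 expR0 mulr1 sub0e -EFinN opprK.
- by move=> t _; rewrite mulr_ge0 ?expR_ge0.
- exact: continuous_subspaceT.
- by rewrite -[X in (_ --> X)%classic](mulr0 (- C)); apply: cvgMr; exact: cvgr_expR.
- by move=> t _; exact: ex_derive.
- apply: cvg_at_right_filter; exact: cN.
- by move=> t _; rewrite derive1E derive_val /GRing.scale/=; ring.
Qed.

(** The first two terms are t^(x-1) (t - x). This is nonnegative for t > x, and for t <= x it is at
    least -x^x since t^(x-1) <= x^(x-1). *)
Let powR_sub_ge x t : 1 <= x -> 0 <= t -> 0 <= t `^ x - x * t `^ (x - 1) + x `^ x.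
Proof.
move=> x1 t0.
have tE y : 1 <= y -> forall u : R, 0 <= u -> u `^ y = u * u `^ (y - 1).
  move=> y1 u; rewrite le_eqVlt => /predU1P[<-|u0].
    by rewrite powR0 ?mul0r// gt_eqF// (lt_le_trans _ y1).
  by rewrite -{2}(powRr1 (ltW u0)) -powRD ?lt0r_neq0 ?implybT// addrC subrK.
have x0 : 0 <= x by rewrite (le_trans _ x1).
rewrite tE// (tE _ x1 x)//.
have [tx|xt] := leP t x.
  have : t `^ (x - 1) <= x `^ (x - 1).
    by apply: ge0_ler_powR; rewrite ?subr_ge0 ?nnegrE.
  have := powR_ge0 t (x - 1); nra.
have := powR_ge0 t (x - 1); have := powR_ge0 x (x - 1); nra.
Qed.

Let gintD1 x : 1 <= x -> gint (x + 1) = (x%:E * gint x)%E.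
Proof.
move=> x1; have x0 : 0 < x by rewrite (lt_le_trans _ x1).
set C := x `^ x.
(* The term [C * expR (- t)] makes the derivative of [F] nonnegative, so that the
   fundamental theorem of calculus applies on the whole half-line. *)
pose F (t : R) := - (t `^ x + C) * expR (- t).
pose f (t : R) := (t `^ x - x * t `^ (x - 1) + C) * expR (- t).
have dF t : 0 < t -> is_derive t 1 F (f t).
  move=> t0; have := is_derive1_powR x t0 => ?.
  apply: is_derive_eq; rewrite /f /GRing.scale/=; ring.
have cE : (continuous (fun t : R => expR (- t)))%classic.
  move=> t; apply/differentiable_continuous/derivable1_diffP; exact: ex_derive.
have cp y t : 0 < t -> {for t, continuous (fun s : R => s `^ y)}%classic.
  move=> t0; apply/differentiable_continuous/derivable1_diffP.
  have := is_derive1_powR y t0 => ?; exact: ex_derive.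
(* The boundary values are F(0) = -C, as 0^x = 0, and F -> 0 at infinity. The bound x >= 1 gives
   t^(x-1) a limit at 0. *)
have FC : (\int[mu]_(t in `[0%R, +oo[%classic) (f t)%:E = C%:E)%E.
  rewrite (@ge0_continuous_FTC2y _ f F 0 0).
  - by rewrite /F powR0 ?gt_eqF// oppr0 expR0 mulr1 sub0e add0r -EFinN opprK.
  - by move=> t t0; rewrite mulr_ge0 ?expR_ge0// powR_sub_ge.
  - apply/continuous_within_itvcyP; split => [t|].
      rewrite in_itv/= andbT => t0; apply: cvgM; last exact: cE.
      apply: cvgD; last exact: cvg_cst.
      apply: cvgB; first exact: cp.
      by apply: cvgMr; exact: cp.
    apply: cvgM; last exact/cvg_at_right_filter/cE.
    apply: cvgD; last exact: cvg_cst.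
    apply: cvgB; first exact/powR_cvg_right0/ltW.
    by apply: cvgMr; apply: powR_cvg_right0; rewrite subr_ge0.
  - rewrite (_ : F = fun t => - (t `^ x * expR (- t)) - C * expR (- t)); last first.
      by apply/funext => t; rewrite /F; ring.
    rewrite -[X in (_ --> X)%classic](_ : - 0 - C * 0 = 0); last by ring.
    apply: cvgB; first by apply: cvgN; exact: powR_expRN_cvg0.
    by apply: cvgMr; exact: cvgr_expR.
  - by move=> t /dF[].
  - apply: cvgM; last exact/cvg_at_right_filter/cE.
    apply: cvgN; apply: cvgD; last exact: cvg_cst.
    exact/powR_cvg_right0/ltW.
  - by move=> t; rewrite in_itv/= andbT derive1E => /dF[_ ->].
have mf (D : set R) : measurable_fun D f.
  apply: measurable_funM; last exact: measurable_expRN.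
  apply: measurable_funD => //; apply: measurable_funB.
    by apply: measurable_funTS; exact: measurable_powR.
  by apply: measurable_funM => //; apply: measurable_funTS; exact: measurable_powR.
have C0 : 0 <= C by exact: powR_ge0.
(* Arranged so that every integrand is nonnegative; only the finite [C] is cancelled, so [gint x]
   may still be infinite here. *)
suff : (C%:E + x%:E * gint x = C%:E + gint (x + 1))%E.
  by move=> /(congr1 (fun z => (z - C%:E)%E))/=; rewrite ![(C%:E + _)%E]addeC !addeK.
rewrite -{1}FC -(integral_expRN _ C0) -integral_itv_obnd_cbnd; last first.
  exact/measurable_EFinP.
rewrite -ge0_integralZl_EFin//; last 3 first.
- by move=> t _; rewrite lee_fin.
- exact: measurable_EFin_gammaf.
- exact: ltW.
rewrite -!ge0_integralD//.
- apply: eq_integral => t _; rewrite -EFinM -!EFinD; congr (_%:E).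
  by rewrite /f /gammaf addrK; ring.
- by move=> t _; rewrite lee_fin mulr_ge0 ?expR_ge0.
- by apply/measurable_EFinP; apply: measurable_funM => //; exact: measurable_expRN.
- by move=> t _; rewrite lee_fin.
- exact: measurable_EFin_gammaf.
- move=> t; rewrite /= in_itv/= andbT => t0.
  by rewrite lee_fin mulr_ge0 ?expR_ge0// powR_sub_ge// ltW.
- by apply/measurable_EFinP; exact: mf.
- by move=> t _; rewrite -EFinM lee_fin mulr_ge0// ltW.
- by apply/measurable_EFinP; apply: measurable_funM => //; exact: measurable_gammaf.
Qed.

Let GammaE x : Gamma x = fine (gint x). Proof. by []. Qed.

Let gint1 : gint 1 = 1%:E.
Proof.
rewrite -(integral_expRN _ ler01); apply: eq_integral => t _.
by rewrite /gammaf subrr powRr0.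
Qed.

(** Integer arguments follow from the recurrence by induction. In general t^(x-1) <= 1 + t^(n+1)
    with [n] the truncation of [x]: the first term dominates on t <= 1, the second on t > 1. *)
Let gint_fin x : 1 <= x -> gint x \is a fin_num.
Proof.
move=> x1.
have finS n : gint (n.+1%:R) \is a fin_num.
  elim: n => [|n IH]; first by rewrite gint1.
  by rewrite -natr1 gintD1 ?ler1n// fin_numM.
rewrite ge0_fin_numE; last by apply: integral_ge0 => t _; rewrite lee_fin.
set n := Num.truncn x.
apply: (@le_lt_trans _ _ (gint 1 + gint (n.+2%:R))%E); last first.
  by rewrite ltey_eq fin_numD gint1 finS.
rewrite /gint -ge0_integralD//; last 4 first.
- by move=> t _; rewrite lee_fin.
- exact: measurable_EFin_gammaf.
- by move=> t _; rewrite lee_fin.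
- exact: measurable_EFin_gammaf.
apply: ge0_le_integral => //.
- by move=> t _; rewrite lee_fin.
- exact: measurable_EFin_gammaf.
- by apply: emeasurable_funD; exact: measurable_EFin_gammaf.
- move=> t; rewrite /= in_itv/= andbT => t0.
  rewrite -EFinD lee_fin -mulrDl ler_pM2r ?expR_gt0// subrr powRr0.
  have [t1|t1] := leP t 1.
    rewrite ler_wpDr ?powR_ge0//.
    have := @ge0_ler_powR _ (x - 1) _ t 1.
    rewrite powR1; apply => //; rewrite ?subr_ge0// nnegrE ltW//.
  rewrite ler_wpDl// ler_powR ?(ltW t1)//.
  by rewrite lerB// (le_trans (ltW (truncnS_gt x)))// ler_nat.
Qed.

Lemma GammaD1 x : 1 <= x -> Gamma (x + 1) = x * Gamma x.
Proof. by move=> x1; rewrite !GammaE gintD1// fineM// gint_fin. Qed.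

Lemma Gamma1 : Gamma (1 : R) = 1.
Proof. by rewrite GammaE gint1. Qed.

Lemma Gamma_ge0 x : 0 <= Gamma x.
Proof. by apply: fine_ge0; apply: integral_ge0 => t _; exact: gammaf_ge0. Qed.

(** Integrate 2 sqrt(x) sqrt(t) <= x + t against t^(x-1) e^(-t); the right side becomes x Gamma(x) +
    Gamma(x+1) = 2 x Gamma(x). *)
Lemma Gamma_half_le x : 1 <= x -> Gamma (x + 1 / 2) <= Num.sqrt x * Gamma x.
Proof.
move=> x1; have x0 : 0 < x by rewrite (lt_le_trans _ x1).
set a := Num.sqrt x; have a0 : 0 < a by rewrite sqrtr_gt0.
have xh1 : 1 <= x + 1 / 2 by lra.
have xS1 : 1 <= x + 1 by lra.
have : ((2 * a)%:E * gint (x + 1 / 2) <= x%:E * gint x + gint (x + 1))%E.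
  rewrite /gint -!ge0_integralZl_EFin//; last 6 first.
  - by move=> t _; rewrite lee_fin.
  - exact: measurable_EFin_gammaf.
  - exact: ltW.
  - by move=> t _; rewrite lee_fin.
  - exact: measurable_EFin_gammaf.
  - by rewrite mulr_ge0// ltW.
  rewrite -ge0_integralD//; last 4 first.
  - by move=> t _; rewrite -EFinM lee_fin mulr_ge0// ltW.
  - by apply/measurable_EFinP; apply: measurable_funM => //; exact: measurable_gammaf.
  - by move=> t _; rewrite lee_fin.
  - exact: measurable_EFin_gammaf.
  apply: ge0_le_integral => //.
  - by move=> t _; rewrite -EFinM lee_fin mulr_ge0// mulr_ge0// ltW.
  - by apply/measurable_EFinP; apply: measurable_funM => //; exact: measurable_gammaf.
  - apply: emeasurable_funD; last exact: measurable_EFin_gammaf.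
    by apply/measurable_EFinP; apply: measurable_funM => //; exact: measurable_gammaf.
  - move=> t; rewrite /= in_itv/= andbT => t0.
    rewrite -!EFinM -EFinD lee_fin /gammaf.
    have -> : x + 1 / 2 - 1 = (x - 1) + 2^-1 by field.
    have -> : x + 1 - 1 = (x - 1) + 2^-1 + 2^-1 by field.
    move: (x - 1) => r.
    rewrite !powRD ?lt0r_neq0 ?implybT// powR12_sqrt ?(ltW t0)//.
    set s := Num.sqrt t.
    have p0 : 0 <= t `^ r * expR (- t) by rewrite mulr_ge0 ?powR_ge0 ?expR_ge0.
    rewrite -subr_ge0 (_ : _ - _ = t `^ r * expR (- t) * (s - a) ^+ 2).
      by rewrite mulr_ge0// sqr_ge0.
    have -> : x = a ^+ 2 by rewrite sqr_sqrtr// ltW.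
    by ring.
rewrite gintD1// -[gint x]fineK ?gint_fin// -[gint (x + 1 / 2)]fineK ?gint_fin//.
rewrite -!EFinM -EFinD lee_fin -!GammaE.
have := sqr_sqrtr (ltW x0); rewrite -/a => a2.
have -> : x * Gamma x + x * Gamma x = 2 * a * (a * Gamma x) by rewrite -a2; ring.
by rewrite ler_pM2l// mulr_gt0.
Qed.

End GammaFunction.

(** * The rising powers of exponent -1/2: recurrence and two-sided bounds *)

Section RisingPower.
Context {R : realType}.

Lemma Gamma_natS_gt0 (n : nat) : 0 < Gamma (n.+1%:R : R).
Proof.
elim: n => [|n IH]; first by rewrite Gamma1.
by rewrite -natr1 GammaD1 ?ler1n// mulr_gt0.
Qed.

Lemma rfpow_addr1 (x r : R) : 1 <= x -> 1 <= x + r ->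
  rfpow (x + 1) r = rfpow x r * ((x + r) / x).
Proof.
move=> x1 xr1; rewrite /rfpow addrAC !GammaD1// invfM; ring.
Qed.

(** This is c_{n+1} = Gamma(n+3/2)/Gamma(n+2): the shift keeps every Gamma argument at least 1. *)
Local Notation c n := (@rfpow R n.+2%:R (- (1 / 2))).

(** If Gamma(n+3/2) vanished, the half-step inequality would give Gamma(n+2) <= 0. *)
Lemma rfpow_half_gt0 (n : nat) : 0 < c n.
Proof.
have n0 := ler0n R n; have G0 := Gamma_natS_gt0 n.+1.
have y1 : 1 <= n.+2%:R - 1 / 2 :> R by rewrite -[n.+2%:R]natr1 -[n.+1%:R]natr1; lra.
apply: divr_gt0 (G0); rewrite lt_def Gamma_ge0 andbT.
apply/eqP => y0; have := Gamma_half_le _ y1.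
by rewrite subrK y0 mulr0 leNgt G0.
Qed.

(** The half-step inequality at n+3/2, squared. *)
Lemma rfpow_half_sqr_ge (n : nat) : 1 <= (n.+1%:R + 1 / 2) * c n ^+ 2.
Proof.
have n0 := ler0n R n.
have y1 : 1 <= n.+1%:R + 1 / 2 :> R by rewrite -[n.+1%:R]natr1; lra.
have xE : n.+2%:R = n.+1%:R + 1 / 2 + 1 / 2 :> R by rewrite -[n.+2%:R]natr1; field.
have := Gamma_half_le _ y1; rewrite -xE => h.
have hc : 1 <= Num.sqrt (n.+1%:R + 1 / 2) * c n.
  rewrite /rfpow mulrA (ler_pdivlMr _ _ (Gamma_natS_gt0 n.+1)) [leLHS]mul1r.
  by have -> : n.+2%:R - 1 / 2 = n.+1%:R + 1 / 2 :> R by rewrite xE addrK.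
rewrite -[X in X * _](@sqr_sqrtr _ (n.+1%:R + 1 / 2)) ?(le_trans ler01)//.
by rewrite -exprMn exprn_ege1.
Qed.

(** Equivalently (n+2) c(n+1) - (n+1) c(n) = c(n)/2, the antidifference identity behind the
    potential bound. *)
Lemma rfpow_halfS (n : nat) :
  c n.+1 = c n * ((n.+1%:R + 1 / 2) / n.+2%:R).
Proof.
have n0 := ler0n R n.
rewrite -[n.+3%:R]natr1 rfpow_addr1 ?ler1n//; last first.
  by rewrite -[n.+2%:R]natr1 -[n.+1%:R]natr1; lra.
by congr (_ * (_ / _)); rewrite -[n.+2%:R]natr1; field.
Qed.

(* [n.+1%:R * c n ^+ 2] is at most 1 by log-convexity and strictly increasing in [n]. *)
Lemma rfpow_half_sqr_lt (n : nat) : n.+1%:R * c n ^+ 2 < 1.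
Proof.
(* The half-step inequality at m+1, combined with Gamma(m+2) = (m+1) Gamma(m+1). *)
have le1 m : m.+1%:R * c m ^+ 2 <= 1.
  have z1 : 1 <= m.+1%:R :> R by rewrite ler1n.
  have z0 : 0 < m.+1%:R :> R by rewrite ltr0n.
  have G0 := Gamma_natS_gt0 m.
  have cE : c m = Gamma (m.+1%:R + 1 / 2) / (m.+1%:R * Gamma m.+1%:R).
    have E : m.+2%:R - 1 / 2 = m.+1%:R + 1 / 2 :> R by rewrite -[m.+2%:R]natr1; field.
    by rewrite -(GammaD1 _ z1) natr1 -E.
  have : Num.sqrt m.+1%:R * c m <= 1.
    rewrite cE mulrA ler_pdivrMr ?mulr_gt0// [leRHS]mul1r.
    rewrite -[X in _ <= X * _](sqr_sqrtr (ltW z0)) expr2 -mulrA.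
    by rewrite ler_wpM2l ?sqrtr_ge0// Gamma_half_le.
  move=> h; rewrite -[X in X * _](sqr_sqrtr (ltW z0)) -exprMn exprn_ile1//.
  by rewrite mulr_ge0 ?sqrtr_ge0// ltW// rfpow_half_gt0.
apply: lt_le_trans (le1 n.+1); rewrite rfpow_halfS.
have := rfpow_half_gt0 n; move: (c n) => u u0; have n0 := ler0n R n.
rewrite -[n.+2%:R]natr1 -[n.+1%:R]natr1; set k : R := n%:R + 1.
have k1 : 1 <= k by rewrite lerDr.
have u20 : 0 < u ^+ 2 by rewrite exprn_gt0.
(* With k = n+1, strict growth reduces to k (k+1) < (k+1/2)^2. *)
rewrite (_ : _ * (u * _) ^+ 2 = u ^+ 2 * ((k + 1 / 2) ^+ 2 / (k + 1))); last by field; lra.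
rewrite [ltLHS]mulrC ltr_pM2l// ltr_pdivlMr; first by nra.
by lra.
Qed.

End RisingPower.

(** * Inner product, quadratic minimizers and subgradient norms *)

Section EuclideanSpace.
Context {R : realType} {d : nat}.
Implicit Types u v w s : 'rV[R]_d.

Lemma dotpC u v : dotp u v = dotp v u.
Proof. by apply: eq_bigr => i _; rewrite mulrC. Qed.

Lemma dotpDl u v w : dotp (u + v) w = dotp u w + dotp v w.
Proof. by rewrite -big_split; apply: eq_bigr => i _; rewrite mxE mulrDl. Qed.

Lemma dotpZl a u w : dotp (a *: u) w = a * dotp u w.
Proof. by rewrite mulr_sumr; apply: eq_bigr => i _; rewrite mxE mulrA. Qed.

Lemma dotpDr u v w : dotp w (u + v) = dotp w u + dotp w v.
Proof. by rewrite dotpC dotpDl !(dotpC w). Qed.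

Lemma dotpZr a u w : dotp w (a *: u) = a * dotp w u.
Proof. by rewrite dotpC dotpZl (dotpC w). Qed.

Lemma dotpBr u v w : dotp w (u - v) = dotp w u - dotp w v.
Proof. by rewrite dotpDr -scaleN1r dotpZr mulN1r. Qed.

Lemma dotp0l w : dotp 0 w = 0.
Proof. by rewrite -(scale0r w) dotpZl mul0r. Qed.

Lemma dotp_ge0 u : 0 <= dotp u u.
Proof. by apply: sumr_ge0 => i _; rewrite -expr2 sqr_ge0. Qed.

Lemma dotp_eq0 u : (dotp u u == 0) = (u == 0).
Proof.
apply/idP/eqP => [|->]; last by rewrite dotp0l.
rewrite psumr_eq0 => [/allP u0|i _]; last by rewrite -expr2 sqr_ge0.
apply/rowP => i; rewrite mxE.
by have := u0 i (mem_index_enum i); rewrite mulf_eq0 orbb => /eqP.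
Qed.

Lemma enorm_ge0 u : 0 <= enorm u.
Proof. exact: sqrtr_ge0. Qed.

Lemma sqr_enorm u : enorm u ^+ 2 = dotp u u.
Proof. by rewrite sqr_sqrtr ?dotp_ge0. Qed.

(** Completing the square: the objective at [u] exceeds its value at -s/(2a) by a times the squared
    distance, so minimality forces equality. *)
Lemma argmin_quadratic (a : R) s u : 0 < a ->
  (forall v, dotp s u + a * enorm u ^+ 2 <= dotp s v + a * enorm v ^+ 2) ->
  u = - (2 * a)^-1 *: s.
Proof.
move=> a0 umin.
set v := - (2 * a)^-1 *: s; have := umin v; rewrite !sqr_enorm => uv.
apply/eqP; rewrite -subr_eq0 -dotp_eq0 eq_le dotp_ge0 andbT.
rewrite -(ler_pM2l a0) mulr0.
suff -> : a * dotp (u - v) (u - v) =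
    (dotp s u + a * dotp u u) - (dotp s v + a * dotp v v) by rewrite subr_le0.
rewrite -[- v]scaleN1r !(dotpDl, dotpDr, dotpZl, dotpZr) (dotpC u s).
by field; rewrite gt_eqF.
Qed.

(** Testing the subgradient inequality at u + v gives |v|^2 <= f(u+v) - f(u) <= G |v|. *)
Lemma subgradient_enorm_le (G : R) (f : 'rV[R]_d -> R) u v :
  0 <= G -> lipschitz_with G f -> is_subgradient f u v -> enorm v <= G.
Proof.
move=> G0 fG /(_ (u + v)); have := fG (u + v) u.
rewrite addrAC subrr add0r -sqr_enorm => /ler_normlP[_ fuv] fuv'.
have : enorm v * enorm v <= G * enorm v by rewrite -expr2; lra.
have := enorm_ge0 v; rewrite le_eqVlt => /predU1P[<- //|v0].
by rewrite ler_pM2r.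
Qed.

End EuclideanSpace.

(** * Potential and regret for abstract weights [c] *)

(* Indices are shifted: [c n] is the paper's [1 / beta_hat n.+1]. *)
Section DualAveraging.
Context {R : realType} {d : nat}.
Context (G Rad : R) (c : nat -> R) (g x s : nat -> 'rV[R]_d).
Context (G0 : 0 < G) (Rad0 : 0 < Rad).
Context (c0 : forall n, 0 < c n).
Context (cS : forall n, c n.+1 = c n * ((n.+1%:R + 1 / 2) / n.+2%:R)).
Context (gG : forall n, enorm (g n) <= G).
Context (x0 : x 0%N = 0) (s0 : s 0%N = 0).
Context (sS : forall n, s n.+1 = s n + g n).
Context (xS : forall n, x n.+1 = - (c n * (Rad / G)) *: s n.+1).

Lemma dual_averaging_potential n :
  \sum_(i < n.+1) dotp (g i) (x i) + c n * (Rad / G) / 2 * dotp (s n.+1) (s n.+1)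
  <= G * Rad * n.+1%:R * c n.
Proof.
have gG2 i : dotp (g i) (g i) <= G ^+ 2.
  by rewrite -sqr_enorm; have := gG i; have := enorm_ge0 (g i); nra.
have h0 : 0 < Rad / G by rewrite divr_gt0.
have hG : Rad / G * G ^+ 2 = G * Rad by field; rewrite gt_eqF.
elim: n => [|n IH].
  rewrite big_ord1 x0 dotpC dotp0l add0r sS s0 add0r mulr1.
  have := gG2 0%N; have := dotp_ge0 (g 0%N); have := c0 0%N.
  rewrite -hG; move: (Rad / G) h0 => h h0 a0 b0 ab.
  have : 0 < c 0%N * h by rewrite mulr_gt0.
  nra.
rewrite big_ord_recr /= xS dotpZr (sS n.+1) !(dotpDl, dotpDr) (dotpC (s n.+1) (g n.+1)).
have n0 := ler0n R n.
have cSn : G * Rad * n.+2%:R * c n.+1 = G * Rad * n.+1%:R * c n + G * Rad * c n / 2.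
  by rewrite cS -[n.+2%:R]natr1 -[n.+1%:R]natr1; field; lra.
rewrite cSn; have cle : c n.+1 <= c n.
  rewrite cS ler_piMr ?ltW// ltr_pdivrMr ?ltr0n// -[n.+2%:R]natr1; lra.
have := gG2 n.+1; have := dotp_ge0 (g n.+1).
have := dotp_ge0 (s n.+1 + g n.+1); rewrite !(dotpDl, dotpDr) (dotpC (s n.+1) (g n.+1)).
move: IH; move: (dotp (s n.+1) (s n.+1)) (dotp (g n.+1) (s n.+1)) (dotp (g n.+1) (g n.+1)).
move: (\sum_(_ < _) _) => S a b e IH q0 e0 eG.
have := c0 n; have := c0 n.+1; move: (c n) (c n.+1) cle IH => u v vu IH v0 u0.
(* Lowering the weight from c(n+1) to c(n) costs nothing. At weight c(n), the cross term of |s +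
   g|^2 cancels <g, x>, leaving only the |g|^2 term. *)
have vuh : v * (Rad / G) / 2 * (a + b + (b + e)) <= u * (Rad / G) / 2 * (a + b + (b + e)).
  by rewrite ler_wpM2r// ler_pM2r// ler_pM2r.
have euh : u * (Rad / G) / 2 * e <= u * (Rad / G) / 2 * G ^+ 2.
  by rewrite ler_wpM2l// divr_ge0// mulr_ge0// ltW.
have -> : G * Rad * u / 2 = u * (Rad / G) / 2 * G ^+ 2 by rewrite -hG; ring.
by lra.
Qed.

(** Young's inequality, from |b s + z|^2 >= 0, gives -<s, z> <= (b/2)|s|^2 + Rad^2/(2b). With b =
    c(n) Rad/G the first term is the one in the potential, and the hypothesis on [c n] bounds the
    second by G Rad (n+1) c(n), the same as the potential. *)
Lemma dual_averaging_regret n z : enorm z <= Rad -> 1 <= 2 * n.+1%:R * c n ^+ 2 ->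
  n.+1%:R^-1 * \sum_(i < n.+1) dotp (g i) (x i - z) <= 2 * Rad * G * c n.
Proof.
move=> zR c2; have n0 : 0 < n.+1%:R :> R by rewrite ltr0n.
have sE : s n.+1 = \sum_(i < n.+1) g i.
  by elim: n.+1 => [|m IH]; rewrite ?big_ord0// big_ord_recr /= -IH sS.
have -> : \sum_(i < n.+1) dotp (g i) (x i - z) =
    \sum_(i < n.+1) dotp (g i) (x i) - dotp (s n.+1) z.
  rewrite sE (big_morph (fun u => dotp u z) (fun u v => dotpDl u v z) (dotp0l z)).
  by rewrite -sumrB; apply: eq_bigr => i _; rewrite dotpBr.
have := dual_averaging_potential n.
have zz : dotp z z <= Rad ^+ 2.
  by rewrite -sqr_enorm; have := enorm_ge0 z; nra.
pose b := c n * (Rad / G); have b0 : 0 < b by rewrite mulr_gt0// divr_gt0.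
have : 0 <= dotp (b *: s n.+1 + z) (b *: s n.+1 + z) by exact: dotp_ge0.
rewrite !(dotpDl, dotpDr, dotpZl, dotpZr) (dotpC z (s n.+1)) -/b.
move: (\sum_(_ < _) _) (dotp (s n.+1) (s n.+1)) (dotp (s n.+1) z) => S q r.
move=> sq; rewrite -/b => hS; rewrite ler_pdivrMl//.
have : b * (- r) <= b * (b / 2 * q + Rad ^+ 2 / (2 * b)).
  rewrite mulrDr [X in _ + X](_ : _ = Rad ^+ 2 / 2); first by nra.
  by field; rewrite gt_eqF.
rewrite ler_pM2l// => hr.
have : Rad ^+ 2 / (2 * b) <= G * Rad * n.+1%:R * c n.
  rewrite ler_pdivrMr ?mulr_gt0 ?invr_gt0// /b.
  have -> : G * Rad * n.+1%:R * c n * (2 * (c n * (Rad / G))) =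
    Rad ^+ 2 * (2 * n.+1%:R * c n ^+ 2) by field; rewrite gt_eqF.
  by rewrite ler_peMr// sqr_ge0.
by lra.
Qed.

End DualAveraging.

(** * The regret bound for the method and its strict comparison with 2RG/sqrt(n+1) *)

(** The regret is affine in [z] and the ball is compact, so bounding the maximum amounts to bounding
    every [z] in the ball. *)
Theorem theorem8 (R : realType) (d : nat) (f : 'rV[R]_d -> R) (G Rad : R)
    (g : 'rV[R]_d -> 'rV[R]_d) (x s : nat -> 'rV[R]_d) :
  0 < G -> convex_fun f -> lipschitz_with G f ->
  (forall y, is_subgradient f y (g y)) ->
  0 < Rad ->
  x 0%N = 0 -> s 0%N = 0 ->
  (forall k : nat, s k.+1 = s k + g (x k)) ->
  (forall (k : nat) (y : 'rV[R]_d),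
     dotp (s k.+1) (x k.+1) + beta_hat k.+1 * ((G / Rad) / 2) * enorm (x k.+1 - x 0%N) ^+ 2
     <= dotp (s k.+1) y + beta_hat k.+1 * ((G / Rad) / 2) * enorm (y - x 0%N) ^+ 2) ->
  forall n : nat,
    (forall z : 'rV[R]_d, enorm z <= Rad ->
       (n.+1%:R)^-1 * \sum_(i < n.+1) dotp (g (x i)) (x i - z)
       <= 2 * Rad * G * rfpow (n.+2%:R) (- (1 / 2)))
    /\ 2 * Rad * G * rfpow (n.+2%:R) (- (1 / 2)) < 2 * Rad * G / Num.sqrt (n.+1%:R).
Proof.
move=> G0 _ fG gsub Rad0 x0 s0 sS xmin n.
pose c k : R := rfpow k.+2%:R (- (1 / 2)).
have c0 k : 0 < c k by exact: rfpow_half_gt0.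
have n0 : 0 < n.+1%:R :> R by rewrite ltr0n.
split=> [z zR|].
  apply: (dual_averaging_regret G Rad c (g \o x) x s) => //.
  - by move=> k; exact: rfpow_halfS.
  - by move=> k; exact: subgradient_enorm_le (ltW G0) fG (gsub _).
  (* The quadratic coefficient is a = beta_hat(k+1) gamma/2, so 1/(2a) = c(k) Rad/G. *)
  - move=> k; have -> : c k * (Rad / G) = (2 * (beta_hat k.+1 * (G / Rad / 2)))^-1.
      rewrite /beta_hat -/(c k); field.
      by rewrite !gt_eqF.
    apply: argmin_quadratic => [|v].
      by apply: mulr_gt0; [exact: divr_gt0 (c0 k)|rewrite !divr_gt0].
    by have := xmin k v; rewrite x0 !subr0.
  (* Here n + 3/2 <= 2(n+1). *)
  - apply: le_trans (rfpow_half_sqr_ge n) _.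
    rewrite ler_wpM2r ?sqr_ge0//.
    have := ler0n R n; rewrite -[n.+1%:R]natr1; lra.
(* Both sides are nonnegative, so squaring reduces the claim to (n+1) c(n)^2 < 1. *)
have q0 : 0 < Num.sqrt n.+1%:R :> R by rewrite sqrtr_gt0.
rewrite ltr_pM2l ?mulr_gt0// -/(c n) -[ltRHS]mul1r ltr_pdivlMr//.
have cq0 : 0 <= c n * Num.sqrt n.+1%:R by apply: mulr_ge0; exact: ltW.
rewrite -(@ltr_pXn2r _ 2) ?nnegrE// expr1n exprMn sqr_sqrtr ?(ltW n0)//.
by rewrite mulrC rfpow_half_sqr_lt.
Qed.
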